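(* Let $G$ be a connected locally isometric graph of order $n \ge 6$ and maximum degree $\Delta(G) = 5$. Then $G$ is either fully cycle extendable, or $G$ is (isomorphic to) a singly shuttered highrise $S_m$ or a doubly shuttered highrise $D_m$ for some $m$.
   Context: All graphs are finite and simple; the order of a graph is its number of vertices. For a vertex $v$, $N(v)$ is its open neighbourhood, $N[v]=N(v)\cup\{v\}$, and $\langle N(v)\rangle$ is the subgraph induced by $N(v)$. A graph $G$ is locally isometric if for every vertex $v$ the graph $\langle N(v)\rangle$ has diameter at most $2$, i.e. any two vertices of $\langle N(v)\rangle$ are at distance at most $2$ in $\langle N(v)\rangle$ (in particular $\langle N(v)\rangle$ is connected). A cycle $C$ in $G$ is extendable if there is a cycle $C'$ in $G$ whose vertex set is $V(C)$ together with exactly one additional vertex. $G$ is fully cycle extendable if every nonhamiltonian cycle of $G$ is extendable and every vertex of $G$ lies on a $3$-cycle. Two vertices $u,v$ are true twins if $N[u]=N[v]$. The join $G+H$ of vertex disjoint graphs is obtained from their union by adding all edges between $V(G)$ and $V(H)$. The strong product $G\boxtimes H$ has vertex set $V(G)\times V(H)$, and $(u,v)$, $(x,y)$ are adjacent iff ($u=x$ and $vy\in E(H)$) or ($v=y$ and $ux\in E(G)$) or ($ux\in E(G)$ and $vy\in E(H)$). $P_k$ is the path on $k$ vertices. Highrise graphs: for $k\ge 2$, $H_{2k+1}$ is obtained from $P_2\boxtimes P_k$ by adding a new vertex and joining it to both vertices of a pair of adjacent vertices of degree $3$ (in $P_2\boxtimes P_k$); $H_{2k+2}$ is obtained from $P_2\boxtimes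 P_k$ by adding two new vertices, joining one of them to both vertices of one pair of adjacent vertices of degree $3$ and the other to both vertices of the other (disjoint) pair of adjacent vertices of degree $3$. (For $k=2$, $P_2\boxtimes P_2=K_4$ and the two pairs are two disjoint edges of $K_4$.) Singly shuttered highrise: $S_5=K_2+\overline{K}_3$, and for $m\ge 6$, $S_m$ is the graph (unique up to isomorphism) obtained from $H_{m-1}$ by adding one new vertex and joining it to both vertices of a pair of true twins of degree at least $4$ in $H_{m-1}$ in such a way that the resulting graph has maximum degree $5$. Doubly shuttered highrise: $D_6=K_2+\overline{K}_4$, and for even $m\ge 8$, $D_m$ is the graph (unique up to isomorphism) obtained from $H_{m-2}$ by adding two new vertices and joining each of them to both vertices of a pair of true twins of degree at least $4$ in $H_{m-2}$ in such a way that the resulting graph has maximum degree $5$. *)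

(* Defs.v *)
(* Finite simple graphs over MathComp's finType. *)
From mathcomp Require Import all_boot.

Set Implicit Arguments.
Unset Strict Implicit.
Unset Printing Implicit Defensive.

Record sgraph := SGraph {
  vertex :> finType;
  adj : rel vertex;
  adj_sym : symmetric adj;
  adj_irrefl : irreflexive adj
}.

Arguments adj {s} _ _.

Section Basics.
Variable G : sgraph.
Implicit Types (v x y : G) (c : seq G).

Definition nbhd v : {set G} := [set w | adj v w].

Definition closed_nbhd v : {set G} := v |: nbhd v.

Definition degree v : nat := #|nbhd v|.

Definition max_degree : nat := \max_(v : G) degree v.

Definition is_path x p y : bool :=
  [&& path adj x p, last x p == y & uniq (x :: p)].

Definition connected : Prop := forall x y, exists p, is_path x p y.

(* A path x :: p has length size p; no such path exists when x and y lie in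
   different components, where the distance is infinite. *)
Definition dist_le k x y : Prop := exists2 p, is_path x p y & size p <= k.

Definition diameter_le k : Prop := forall x y, dist_le k x y.

(* [cycle] and [uniq] alone would also accept [::] and a single edge [:: x; y]. *)
Definition is_cycle c : bool := [&& 2 < size c, cycle adj c & uniq c].

Definition hamiltonian_cycle c : Prop := is_cycle c /\ [set x in c] = [set: G].

Definition extendable c : Prop :=
  exists c' w, [/\ is_cycle c', w \notin c & [set x in c'] = w |: [set x in c]].

Definition fully_cycle_extendable : Prop :=
  (forall c, is_cycle c -> ~ hamiltonian_cycle c -> extendable c) /\
  (forall v, exists c, [/\ is_cycle c, size c = 3 & v \in c]).

Definition true_twins x y : Prop := x <> y /\ closed_nbhd x = closed_nbhd y.

End Basics.

Definition isomorphic (G H : sgraph) : Prop :=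
  exists2 f : G -> H, bijective f & forall x y, adj (f x) (f y) = adj x y.

Section Induced.
Variables (G : sgraph) (A : {set G}).

Definition induced_adj : rel {x : G | x \in A} :=
  fun x y => adj (val x) (val y).

Lemma induced_adj_sym : symmetric induced_adj.
Proof. by move=> x y; rewrite /induced_adj adj_sym. Qed.

Lemma induced_adj_irrefl : irreflexive induced_adj.
Proof. by move=> x; rewrite /induced_adj adj_irrefl. Qed.

Definition induced : sgraph := SGraph induced_adj_sym induced_adj_irrefl.
End Induced.

Definition locally_isometric (G : sgraph) : Prop :=
  forall v : G, diameter_le (induced (nbhd v)) 2.

Section Complete.
Variable n : nat.

Definition complete_adj : rel 'I_n := fun x y => x != y.

Lemma complete_adj_sym : symmetric complete_adj.
Proof. by move=> x y; rewrite /complete_adj eq_sym. Qed.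

Lemma complete_adj_irrefl : irreflexive complete_adj.
Proof. by move=> x; rewrite /complete_adj eqxx. Qed.

Definition complete_graph : sgraph := SGraph complete_adj_sym complete_adj_irrefl.
End Complete.

Section Complement.
Variable G : sgraph.

Definition compl_adj : rel G := fun x y => (x != y) && ~~ adj x y.

Lemma compl_adj_sym : symmetric compl_adj.
Proof. by move=> x y; rewrite /compl_adj eq_sym adj_sym. Qed.

Lemma compl_adj_irrefl : irreflexive compl_adj.
Proof. by move=> x; rewrite /compl_adj eqxx. Qed.

Definition complement : sgraph := SGraph compl_adj_sym compl_adj_irrefl.
End Complement.

Section PathGraph.
Variable k : nat.

Definition pathg_adj : rel 'I_k := fun i j => (i.+1 == j) || (j.+1 == i).

Lemma pathg_adj_sym : symmetric pathg_adj.
Proof. by move=> i j; rewrite /pathg_adj orbC. Qed.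

Lemma pathg_adj_irrefl : irreflexive pathg_adj.
Proof. by move=> i; rewrite /pathg_adj orbb eqn_leq ltnn. Qed.

Definition path_graph : sgraph := SGraph pathg_adj_sym pathg_adj_irrefl.
End PathGraph.

Section Join.
Variables G H : sgraph.

Definition join_adj : rel (G + H)%type := fun a b =>
  match a, b with
  | inl x, inl y => adj x y
  | inr x, inr y => adj x y
  | _, _ => true
  end.

Lemma join_adj_sym : symmetric join_adj.
Proof. by move=> [x|x] [y|y] //=; rewrite adj_sym. Qed.

Lemma join_adj_irrefl : irreflexive join_adj.
Proof. by move=> [x|x] /=; rewrite adj_irrefl. Qed.

Definition join : sgraph := SGraph join_adj_sym join_adj_irrefl.
End Join.

Section StrongProduct.
Variables G H : sgraph.

Definition strong_adj : rel (G * H)%type := fun a b =>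
  [|| (a.1 == b.1) && adj a.2 b.2,
      (a.2 == b.2) && adj a.1 b.1
    | adj a.1 b.1 && adj a.2 b.2].

Lemma strong_adj_sym : symmetric strong_adj.
Proof.
move=> a b; rewrite /strong_adj (eq_sym a.1) (eq_sym a.2).
by rewrite (adj_sym a.1) (adj_sym a.2).
Qed.

Lemma strong_adj_irrefl : irreflexive strong_adj.
Proof. by move=> a; rewrite /strong_adj !adj_irrefl !andbF. Qed.

Definition strong_product : sgraph := SGraph strong_adj_sym strong_adj_irrefl.
End StrongProduct.

(* The graph [G] with one new vertex [None], joined to both [u] and [v]; the
   old vertex [x] of [G] becomes [Some x]. *)
Section Attach.
Variables (G : sgraph) (u v : G).

Definition attach_adj : rel (option G) := fun a b =>
  match a, b with
  | Some x, Some y => adj x y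
  | None, Some x | Some x, None => (x == u) || (x == v)
  | None, None => false
  end.

Lemma attach_adj_sym : symmetric attach_adj.
Proof. by move=> [x|] [y|] //=; rewrite adj_sym. Qed.

Lemma attach_adj_irrefl : irreflexive attach_adj.
Proof. by move=> [x|] //=; rewrite adj_irrefl. Qed.

Definition attach : sgraph := SGraph attach_adj_sym attach_adj_irrefl.
End Attach.

(* Two new, mutually nonadjacent vertices, the first joined to [u] and [v], the
   second to [x] and [y]. *)
Definition attach2 (G : sgraph) (u v x y : G) : sgraph :=
  @attach (attach u v) (Some x) (Some y).

Definition tower (k : nat) : sgraph :=
  strong_product (path_graph 2) (path_graph k).

Definition corner_pair (k : nat) (u v : tower k) : Prop :=
  [/\ adj u v, degree u = 3 & degree v = 3].

Definition is_highrise (m : nat) (G : sgraph) : Prop :=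
  exists k, 2 <= k /\
    ((m = 2 * k + 1 /\
        exists u v : tower k, corner_pair u v /\ isomorphic G (attach u v))
  \/ (m = 2 * k + 2 /\
        exists u v x y : tower k,
          [/\ corner_pair u v, corner_pair x y,
              [disjoint [set u; v] & [set x; y]]
            & isomorphic G (attach2 u v x y)])).

Definition shutter_pair (H : sgraph) (u v : H) : Prop :=
  [/\ true_twins u v, 4 <= degree u & 4 <= degree v].

Definition is_singly_shuttered (m : nat) (G : sgraph) : Prop :=
  (m = 5 /\ isomorphic G (join (complete_graph 2) (complement (complete_graph 3))))
  \/ (6 <= m /\
      exists2 H : sgraph, is_highrise m.-1 H &
        exists u v : H,
          [/\ shutter_pair u v, max_degree (attach u v) = 5
            & isomorphic G (attach u v)]).

(* The two shutter pairs are not required to differ: the degree bound already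
   excludes attaching both new vertices to the same pair. *)
Definition is_doubly_shuttered (m : nat) (G : sgraph) : Prop :=
  (m = 6 /\ isomorphic G (join (complete_graph 2) (complement (complete_graph 4))))
  \/ (8 <= m /\ ~~ odd m /\
      exists2 H : sgraph, is_highrise (m - 2) H &
        exists u v x y : H,
          [/\ shutter_pair u v, shutter_pair x y,
              max_degree (attach2 u v x y) = 5
            & isomorphic G (attach2 u v x y)]).

(* Main.v *)
Require Import Defs.
From mathcomp Require Import all_boot.
From mathcomp Require Import zify.
From Stdlib Require Import Classical.

(* Let C be a nonextendable nonhamiltonian cycle and x a vertex off C adjacent
   to a vertex v of C. Since <N(v)> has diameter at most 2, x has common
   neighbours in N(v) with the successor and with the predecessor of v on C.
   The degree bound 5 then forces a vertex w adjacent to x, to v and to both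
   cycle neighbours of v, possibly after exchanging v and w. Around such a pair
   v, w every neighbourhood is determined: v and w are true twins of degree 5
   that have two common neighbours of degree 2 (a fork).
   Starting at a fork, local isometry propagates the structure upwards: the
   vertices outside that are adjacent to one top vertex of a ladder are adjacent
   to both, there are at most two of them, and either they form the next rung or
   they are leaves that end the graph. *)

Set Implicit Arguments.
Unset Strict Implicit.
Unset Printing Implicit Defensive.

(** * Local isometry, degree bounds and cycles *)

(** A path of length at most 2 between distinct nonadjacent vertices of the graph induced on N(v)
    has exactly one interior vertex. This is the only form in which local isometry is used. *)
Lemma common_nbr (G : sgraph) (v x y : G) :
  locally_isometric G -> adj v x -> adj v y -> x != y -> ~~ adj x y ->
  exists w, [/\ adj v w, adj x w & adj y w].
Proof.
move=> hli vx vy neq nadj.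
have vx' : x \in nbhd v by rewrite inE.
have vy' : y \in nbhd v by rewrite inE.
have [p /and3P[pp /eqP lastp _]] :=
  hli v (exist _ x vx' : induced (nbhd v)) (exist _ y vy').
move/(congr1 val): lastp; rewrite /=.
case: p pp => [|u [|u' [|//]]] /=; first by move=> _ xy; rewrite xy eqxx in neq.
  by rewrite /induced_adj /= andbT => xu uy; rewrite uy (negPf nadj) in xu.
rewrite /induced_adj /= andbT => /andP[xu uu'] u'y _.
by exists (val u); split=> //; [have:= valP u; rewrite inE | rewrite -u'y adj_sym].
Qed.

(** Once as many distinct neighbours are found as the degree bound allows, the whole neighbourhood
    is known. It is applied with lists of five neighbours. *)
Lemma adj_mem_max (G : sgraph) (v : G) (s : seq G) :
  degree v <= size s -> uniq s -> all (adj v) s -> adj v =1 mem s.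
Proof.
move=> dv us /allP vs z.
have sub : [set x in s] \subset nbhd v by apply/subsetP=> x; rewrite !inE => /vs.
have cs : #|[set x in s]| = size s by rewrite cardsE; apply/card_uniqP.
have: [set x in s] == nbhd v by rewrite eqEcard sub cs.
by move/eqP/setP/(_ z); rewrite !inE.
Qed.

Lemma connected_closed (G : sgraph) (P : pred G) (x0 : G) :
  connected G -> P x0 -> (forall x y, P x -> adj x y -> P y) -> forall x, P x.
Proof.
move=> con P0 clP x; have [p /and3P[pp /eqP<- _]] := con x0 x.
elim: p x0 P0 pp => //= y p IH x0 P0 /andP[xy]; apply: IH; exact: clP xy.
Qed.

Lemma degree_le_max (G : sgraph) (v : G) : degree v <= max_degree G.
Proof. exact: leq_bigmax. Qed.

Lemma is_cycle_rot (G : sgraph) n (c : seq G) : is_cycle (rot n c) = is_cycle c.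
Proof. by rewrite /is_cycle size_rot rot_cycle rot_uniq. Qed.

Lemma is_cycle_rev (G : sgraph) (c : seq G) : is_cycle (rev c) = is_cycle c.
Proof.
rewrite /is_cycle size_rev rev_cycle rev_uniq; congr [&& _, _ & _].
by apply: eq_cycle => x y; rewrite adj_sym.
Qed.

Lemma extendable_eq_mem (G : sgraph) (c d : seq G) :
  c =i d -> extendable c -> extendable d.
Proof.
move=> cd [c' [w [cyc wc eqs]]]; exists c', w; split; rewrite -?cd //.
by rewrite eqs; congr (_ |: _); apply/setP=> z; rewrite !inE cd.
Qed.

Lemma extendable_insert (G : sgraph) (c c' : seq G) (x : G) :
  x \notin c -> perm_eq c' (x :: c) -> uniq c -> 1 < size c -> cycle adj c' ->
  extendable c.
Proof.
move=> xc per uc sc cyc; exists c', x; split=> //.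
  by rewrite /is_cycle (perm_size per) (perm_uniq per) /= xc uc cyc ltnS sc.
by apply/setP=> z; rewrite !inE (perm_mem per) inE.
Qed.

(** * Nonextendable cycles *)

Section NonextendableCycle.
Variables (G : sgraph) (c : seq G).
Hypotheses (cyc : is_cycle c) (nonext : ~ extendable c).

Let uc : uniq c. Proof. by case/and3P: cyc. Qed.
Let sc : 2 < size c. Proof. by case/and3P: cyc. Qed.
Let cc : cycle adj c. Proof. by case/and3P: cyc. Qed.

Lemma adj_next v : v \in c -> adj v (next c v).
Proof. exact: next_cycle. Qed.

Lemma adj_prev v : v \in c -> adj v (prev c v).
Proof. by move=> vc; rewrite adj_sym; apply: prev_cycle. Qed.

Lemma next_neq_prev v : v \in c -> next c v != prev c v.
Proof.
move=> vc; have [i s def] := rot_to vc.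
rewrite -(next_rot i uc) -(prev_rot i uc) def.
have: uniq (v :: s) by rewrite -def rot_uniq.
have: 2 < size (v :: s) by rewrite -def size_rot.
clear; case: s => [|a [|b s]] //= _ /and3P[va ab _].
rewrite eqxx; apply/negP=> /eqP aE.
(* The predecessor of the first entry [v] is the last entry, which lies in [b :: s]; but [a] does
   not. *)
have/negP[] := ab; rewrite {1}aE.
move: va; rewrite !inE !negb_or => /and3P[/negPf-> /negPf-> vs].
elim: s b vs {ab aE} => [|d s IH] b; first by rewrite /= !eqxx.
rewrite /=; by rewrite !inE negb_or => /andP[/negPf-> /(IH d)]; rewrite orbC => ->; rewrite ?orbT.
Qed.

(** Otherwise x could be inserted between v and its successor. *)
Lemma next_not_adj_ext v x : v \in c -> x \notin c -> adj v x -> ~~ adj (next c v) x.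
Proof.
move=> vc xc vx; apply/negP=> nx; apply: nonext.
have [i s def] := rot_to vc.
have mem_def : rot i c =i c by move=> z; rewrite mem_rot.
apply: (extendable_eq_mem mem_def); rewrite def.
have:= is_cycle_rot i c; rewrite cyc def => /and3P[sv cv uv].
move: nx xc; rewrite -(next_rot i uc) -mem_def def.
case: s sv cv uv {def mem_def} => [|a s] //= sv /andP[va pa] uv.
rewrite eqxx => ax xc.
apply: (@extendable_insert _ _ [:: v, x, a & s] x) => //=.
  by rewrite (perm_catCA [:: v] [:: x] (a :: s)).
by rewrite vx adj_sym ax.
Qed.

Lemma nexts_not_adj v w x :
  v \in c -> w \in c -> x \notin c -> v != w -> adj v x -> adj w x ->
  ~~ adj (next c v) (next c w).
Proof.
move=> vc wc xc vw vx wx; apply/negP=> nn; apply: nonext.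
have [i s def] := rot_to vc.
have mem_def : rot i c =i c by move=> z; rewrite mem_rot.
apply: (extendable_eq_mem mem_def); rewrite def.
have:= is_cycle_rot i c; rewrite cyc def => /and3P[sv cv uv].
have:= next_not_adj_ext vc xc vx; have:= next_not_adj_ext wc xc wx.
move: nn xc wc; rewrite -!(next_rot i uc) -!mem_def def.
rewrite (in_cons v s w) eq_sym (negPf vw) orFb => nn xc ws.
case/splitPr: ws sv cv uv nn xc {def mem_def} => s1 s2 sv cv uv.
(* The default [v] covers the case where w is the last entry and the cycle wraps around. *)
have -> : next (v :: s1 ++ w :: s2) w = head v s2.
  have ur : uniq (v :: s1) by move: uv; rewrite -cat_cons cat_uniq => /andP[].
  rewrite -(next_rot (size s1).+1 uv) -cat_cons -[(size s1).+1]/(size (v :: s1)).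
  by rewrite rot_size_cat /=; case: (s2) => [|d s2'] /=; rewrite eqxx.
(* If w follows v, or v follows w, then x is adjacent to two consecutive vertices, which
   [next_not_adj_ext] excludes. *)
case: s1 sv cv uv => [|b s1] /= sv cv uv; rewrite eqxx => nn xc nwx.
  by rewrite wx.
case: s2 nn nwx sv cv uv xc => [|d s2] /= nn; first by rewrite vx.
move=> _ sv cv uv xc _.
(* Replace v ... w w+ ... by v x w ... v+ w+ ..., reversing the segment from v+ to w. *)
apply: (@extendable_insert _ _ ([:: x, w & rev (b :: s1)] ++ rcons (d :: s2) v) x) => //.
  apply/permP=> P; rewrite -cats1 rev_cons -cats1 /= !(count_cat, count_rev) /=.
  by rewrite count_cat /=; clear; lia.
move: cv; rewrite /= rcons_cat /= cat_path /= => /and3P[vb p1 /and3P[lw wd p2]].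
rewrite adj_sym wx /= rcons_cat cat_path /=.
have Hl : last w (rev (b :: s1)) = b by rewrite rev_cons last_rcons.
rewrite Hl nn.
have p2' : path adj d (rcons (rcons s2 v) x).
  by rewrite rcons_path p2 last_rcons vx.
rewrite p2' andbT.
have := rev_path adj b (rcons s1 w); rewrite last_rcons belast_rcons => ->.
rewrite (eq_path (e' := adj)) ?rcons_path ?p1 ?lw //.
by move=> ? ?; rewrite adj_sym.
Qed.

Lemma nonext_rev : ~ extendable (rev c).
Proof. by move=> ext; apply: nonext; apply: extendable_eq_mem ext => z; rewrite mem_rev. Qed.

Lemma next_closed (P : pred G) v :
  v \in c -> P v -> (forall x, P x -> P (next c x)) -> {in c, forall x, P x}.
Proof.
move=> vc Pv clP; have [i s def] := rot_to vc.
have: fcycle (next c) (v :: s) by rewrite -def rot_cycle cycle_next.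
rewrite /= rcons_path => /andP[fs _] z; rewrite -(mem_rot i) def.
elim: s (v) Pv fs {def} => [|u s IH] v' Pv /=; first by rewrite inE => _ /eqP->.
case/andP=> /eqP vu fs; rewrite in_cons => /predU1P[->//|].
by apply: IH => //; rewrite -vu; exact: clP.
Qed.

End NonextendableCycle.

Section PrevNonextendable.
Variables (G : sgraph) (c : seq G).
Hypotheses (cyc : is_cycle c) (nonext : ~ extendable c).

Let cyc' : is_cycle (rev c). Proof. by rewrite is_cycle_rev. Qed.
Let uc : uniq c. Proof. by case/and3P: cyc. Qed.

(** Reversing the cycle exchanges successors and predecessors and preserves nonextendability. *)
Lemma prev_not_adj_ext v x : v \in c -> x \notin c -> adj v x -> ~~ adj (prev c v) x.
Proof.
move=> vc xc; rewrite -(next_rev uc).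
by apply: next_not_adj_ext => //; [exact: nonext_rev | rewrite mem_rev..].
Qed.

Lemma prevs_not_adj v w x :
  v \in c -> w \in c -> x \notin c -> v != w -> adj v x -> adj w x ->
  ~~ adj (prev c v) (prev c w).
Proof.
move=> vc wc xc; rewrite -!(next_rev uc).
by apply: nexts_not_adj => //; [exact: nonext_rev | rewrite mem_rev..].
Qed.

End PrevNonextendable.

(** * Leaves and forks from nonextendable cycles *)

Lemma adj_neq (G : sgraph) (x y : G) : adj x y -> x != y.
Proof. by apply: contraTneq => ->; rewrite adj_irrefl. Qed.

Ltac distinct := rewrite /= ?inE ?negb_or; repeat (apply/andP; split);
  first [done | rewrite eq_sym; done
        | apply: adj_neq; done | rewrite eq_sym; apply: adj_neq; done].

(** A further neighbour z of a would be adjacent to neither v nor w. Local isometry at a would join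
    z to v through a common neighbour in N(a); within N(v) only w is adjacent to a, and w is not
    adjacent to z. *)
Lemma leaf_nbhd (G : sgraph) (v w a : G) (s : seq G) :
  locally_isometric G -> adj v =1 mem (w :: s) -> adj w =1 mem (v :: s) ->
  a \in s -> (forall u, u \in s -> ~~ adj a u) -> adj a =1 mem [:: v; w].
Proof.
move=> hli Nv Nw as_ na z; rewrite /= !inE.
have av : adj a v by rewrite adj_sym Nv /= inE as_ orbT.
have aw : adj a w by rewrite adj_sym Nw /= inE as_ orbT.
apply/idP/idP=> [az|/orP[/eqP->|/eqP->] //].
apply: contraT; rewrite negb_or => /andP[zv zw].
have nz : z \notin s by apply: contraL az; apply: na.
have nzv : ~~ adj z v by rewrite adj_sym Nv /= inE negb_or zw.
have [u [au zu vu]] := common_nbr hli az av zv nzv.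
move: vu; rewrite Nv /= inE => /predU1P[uw|/na]; last by rewrite au.
by move: zu; rewrite uw adj_sym Nw /= inE (negPf zv) (negPf nz).
Qed.

(* The true twins v, w have degree 5 and the two leaves a, b of degree 2; p and q
   are the neighbours through which the graph may continue. *)
Definition fork (G : sgraph) (a b v w p q : G) : Prop :=
  [/\ uniq [:: a; b; v; w; p; q],
      adj v =1 mem [:: w; a; b; p; q], adj w =1 mem [:: v; a; b; p; q],
      adj a =1 mem [:: v; w] & adj b =1 mem [:: v; w]].

Section Fork.
Variable G : sgraph.
Hypotheses (con : connected G) (hli : locally_isometric G).
Hypotheses (deg : forall v : G, degree v <= 5) (ord : 5 < #|G|).

(** Let a be the vertex between v and w on the cycle, p the predecessor of v and q the successor of
    w. If p and q differ, five neighbours of w are known and the leaves are x and a. If they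
    coincide, the cycle is the 4-cycle v, a, w, p; since the order exceeds five there is one more
    neighbour y, and the leaves are a and p. *)
Lemma two_step_fork (c : seq G) v w x :
  is_cycle c -> ~ extendable c -> v \in c -> x \notin c -> adj v x ->
  adj v w -> adj x w -> adj w (prev c v) -> w = next c (next c v) ->
  exists a b v w p q : G, fork a b v w p q.
Proof.
move=> cyc nonext vc xc vx vw xw wp def_w.
have uc : uniq c by case/and3P: cyc.
set a := next c v in def_w *; set p := prev c v in wp *; pose q := next c w.
have ac : a \in c by rewrite mem_next.
have wc : w \in c by rewrite def_w mem_next.
have va : adj v a by rewrite adj_next.
have vp : adj v p by rewrite adj_prev.
have aw : adj a w by rewrite def_w adj_next.
have wq : adj w q by rewrite adj_next.
have ap : a != p by rewrite next_neq_prev.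
have pw : prev c w = a by rewrite def_w prev_next.
have aq : a != q by rewrite -pw eq_sym next_neq_prev.
have nvw := adj_neq vw; have wx : adj w x by rewrite adj_sym.
have nax : ~~ adj a x by apply: next_not_adj_ext.
have npx : ~~ adj p x by apply: prev_not_adj_ext.
have nqx : ~~ adj q x by apply: next_not_adj_ext.
have nap : ~~ adj a p by rewrite -pw adj_sym; apply: (@prevs_not_adj _ c _ _ _ _ x).
have naq : ~~ adj a q by apply: (@nexts_not_adj _ c _ _ _ _ x).
have xNc z : z \in c -> x != z by move=> zc; apply: contraNneq xc => ->.
have [xa xp xq] : [/\ x != a, x != p & x != q].
  by split; apply: xNc; rewrite ?mem_next ?mem_prev.
have wa : adj w a by rewrite adj_sym.
have [pq|npq] := eqVneq p q; last first.
  have nvq : v != q by apply: contraNneq nqx => <-.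
  have Nw : adj w =1 mem [:: v; x; a; p; q].
    apply: adj_mem_max => //=; last by rewrite wx wa wp wq adj_sym vw.
    by distinct.
  have xq' : ~~ adj x q by rewrite adj_sym.
  have vq : adj v q.
    (* Among the five neighbours of w only v can be adjacent to both x and q. *)
    have [u [wu xu qu]] := common_nbr hli wx wq xq xq'.
    move: wu; rewrite Nw /= !inE => /or4P[/eqP uv|/eqP ux|/eqP ua|/orP[]/eqP up].
    - by rewrite adj_sym -uv.
    - by rewrite ux adj_irrefl in xu.
    - by rewrite adj_sym ua (negPf nax) in xu.
    - by rewrite adj_sym up (negPf npx) in xu.
    - by rewrite up adj_irrefl in qu.
  have Nv : adj v =1 mem [:: w; x; a; p; q].
    apply: adj_mem_max => //=; last by rewrite vx va vp vq vw.
    by distinct.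
  have Na : adj a =1 mem [:: v; w].
    apply: (leaf_nbhd hli Nv Nw); first by rewrite !inE eqxx ?orbT.
    by move=> u; rewrite !inE => /or4P[] /eqP-> //; rewrite adj_irrefl.
  have Nx : adj x =1 mem [:: v; w].
    apply: (leaf_nbhd hli Nv Nw); first by rewrite !inE eqxx ?orbT.
    by move=> u; rewrite !inE => /or4P[] /eqP->; rewrite ?adj_irrefl // adj_sym.
  exists x, a, v, w, p, q; split=> //.
  by distinct.
(* Here p = q, so the successor map keeps these four vertices among themselves and they make up the
   whole cycle. *)
have in_c : {in c, forall z, z \in [:: v; a; w; p]}.
  apply: (next_closed cyc vc); first by rewrite !inE eqxx.
  move=> z; rewrite !inE => /or4P[] /eqP->; rewrite -/a -?def_w -/q -?pq ?eqxx ?orbT //.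
  by rewrite next_prev // eqxx.
have nvp := adj_neq vp; have nwp := adj_neq wp; have nwa := adj_neq wa.
(* The situation is symmetric in v and w, so this is used with either as v'. A fifth neighbour y of
   v' needs a common neighbour with a in N(v'), and only w' is left. *)
have outer v' w' y : adj v' w' -> adj v' x -> adj v' a -> adj v' p -> adj w' a ->
    adj w' x -> adj w' p ->
    adj v' y -> y \notin [:: w'; x; a; p] -> ~~ adj a y ->
    adj v' =1 mem [:: w'; x; a; p; y] /\ adj w' y.
  move=> v'w' v'x v'a v'p w'a w'x w'p v'y; rewrite !inE !negb_or => /and4P[yw yx ya yp] nay.
  have Nv' : adj v' =1 mem [:: w'; x; a; p; y].
    apply: adj_mem_max => //=; last by rewrite v'w' v'x v'a v'p v'y.
    by distinct.
  split=> //; have ay : a != y by rewrite eq_sym.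
  have [u [v'u au yu]] := common_nbr hli v'a v'y ay nay.
  move: v'u; rewrite Nv' /= !inE => /or4P[/eqP uv|/eqP ux|/eqP ua|/orP[]/eqP up].
  - by rewrite adj_sym -uv.
  - by rewrite -ux au in nax.
  - by rewrite ua adj_irrefl in au.
  - by rewrite -up au in nap.
  - by rewrite up adj_irrefl in yu.
have wv : adj w v by rewrite adj_sym.
(* Both a and p are cycle neighbours of v and of w, so neither is adjacent to a vertex off the cycle
   that is adjacent to v or w. *)
have outc v' y : adj v' y -> v' \in [:: v; w] -> y \notin [:: v; w; x; a; p] ->
    ~~ adj a y /\ ~~ adj p y.
  move=> v'y v'vw; rewrite !inE !negb_or => /and5P[yv yw yx ya yp].
  have yc : y \notin c.
    by apply/negP=> /in_c; rewrite !inE (negPf yv) (negPf yw) (negPf ya) (negPf yp).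
  move: v'vw v'y; rewrite !inE => /orP[]/eqP-> vy.
    by rewrite next_not_adj_ext // prev_not_adj_ext.
  by rewrite -{1}pw pq next_not_adj_ext // prev_not_adj_ext.
have leaf_mem y s : adj v =1 mem [:: w, x, a, p & s] ->
    adj w =1 mem [:: v, x, a, p & s] -> y \in [:: x; a; p] ->
    (forall u, u \in s -> ~~ adj y u) -> adj y =1 mem [:: v; w].
  move=> Nv Nw ys nys; apply: (leaf_nbhd hli Nv Nw).
    by move: ys; rewrite !inE !orbA => ->.
  move=> u; rewrite -[[:: x, a, p & s]]/([:: x; a; p] ++ s) mem_cat => /orP[|/nys //].
  move: ys; rewrite !inE => /or3P[] /eqP-> /or3P[] /eqP->; rewrite ?adj_irrefl //.
  1-3: by rewrite adj_sym.
case: (pickP [pred y | (adj v y || adj w y) && (y \notin [:: v; w; x; a; p])]).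
  move=> y /=; rewrite !inE !negb_or => /andP[vwy yn].
  have [yv yw yx ya yp] : [/\ y != v, y != w, y != x, y != a & y != p].
    by case/and5P: yn.
  have yn' : y \notin [:: v; w; x; a; p] by rewrite !inE !negb_or.
  have yNvw z : z \in [:: v; w] -> y \notin [:: z; x; a; p].
    by rewrite !inE !negb_or => /orP[]/eqP->; rewrite ?yv ?yw yx ya yp.
  have [vy wy nay npy] : [/\ adj v y, adj w y, ~~ adj a y & ~~ adj p y].
    case/orP: vwy => vy; have [|nay npy] := outc _ _ vy _ yn'; rewrite ?inE ?eqxx ?orbT //.
      by case: (outer v w y); rewrite ?yNvw ?inE ?eqxx ?orbT.
    by case: (outer w v y); rewrite ?yNvw ?inE ?eqxx ?orbT.
  have [Nv _] : adj v =1 mem [:: w; x; a; p; y] /\ adj w y.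
    by apply: outer; rewrite ?yNvw ?inE ?eqxx ?orbT.
  have [Nw _] : adj w =1 mem [:: v; x; a; p; y] /\ adj v y.
    by apply: outer; rewrite ?yNvw ?inE ?eqxx ?orbT.
  have Na : adj a =1 mem [:: v; w].
    by apply: (leaf_mem a [:: y]); rewrite ?inE ?eqxx ?orbT // => u; rewrite inE => /eqP->.
  have Np : adj p =1 mem [:: v; w].
    by apply: (leaf_mem p [:: y]); rewrite ?inE ?eqxx ?orbT // => u; rewrite inE => /eqP->.
  exists a, p, v, w, x, y; split=> //.
  - by distinct.
  - by move=> z; rewrite Nv /= !inE; do !bool_congr.
  - by move=> z; rewrite Nw /= !inE; do !bool_congr.
(* Without such a y, the set of v, w, x, a, p is closed under adjacency, so connectivity leaves only
   five vertices, against [ord]. *)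
move=> none.
have in5 z : adj v z || adj w z -> z \in [:: v; w; x; a; p].
  by move=> zz; have:= none z; rewrite /= zz => /negbFE.
have N4 v' w' : adj v' w' -> adj v' x -> adj v' a -> adj v' p ->
    (forall z, adj v' z -> z \in [:: v'; w'; x; a; p]) -> adj v' =1 mem [:: w'; x; a; p].
  move=> v'w' v'x v'a v'p sub z; apply/idP/idP => /= [v'z|].
    by have:= sub z v'z; rewrite inE => /predU1P[zE|//]; rewrite zE adj_irrefl in v'z.
  by rewrite !inE => /or4P[] /eqP->.
have Nv : adj v =1 mem [:: w; x; a; p].
  by apply: N4 => // z vz; apply: in5; rewrite vz.
have Nw : adj w =1 mem [:: v; x; a; p].
  by apply: N4 => // z wz; have:= in5 z; rewrite wz orbT !inE orbCA => ->.
have all5 : forall z, z \in [:: v; w; x; a; p].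
  apply: (@connected_closed _ (fun z => z \in [:: v; w; x; a; p]) v con).
    by rewrite !inE eqxx.
  move=> y z; rewrite [y \in _]inE => /predU1P[->|].
    by rewrite Nv /= !inE => ->; rewrite !orbT.
  rewrite [y \in _]inE => /predU1P[->|ys].
    by rewrite Nw /= !inE => /orP[->//|->]; rewrite !orbT.
  by rewrite (leaf_mem y [::]) //= !inE => /orP[->|->]; rewrite ?orbT.
have: #|G| <= size [:: v; w; x; a; p].
  by apply: leq_trans (card_size _); apply: subset_leq_card; apply/subsetP=> z _.
by rewrite leqNgt ord.
Qed.

(** If w is two steps from v along the cycle in either direction, [two_step_fork] applies to the
    cycle or to its reversal. Otherwise v, x and the cycle neighbours of v and of w are six distinct
    neighbours of w, against the degree bound. *)
Lemma hub_fork (c : seq G) v w x :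
  is_cycle c -> ~ extendable c -> v \in c -> x \notin c -> adj v x ->
  adj v w -> adj x w -> adj w (next c v) -> adj w (prev c v) ->
  exists a b v w p q : G, fork a b v w p q.
Proof.
move=> cyc nonext vc xc vx vw xw wn wp.
have uc : uniq c by case/and3P: cyc.
have wx : adj w x by rewrite adj_sym.
have wc : w \in c.
  apply: contraLR wn => wc; rewrite adj_sym.
  exact: (next_not_adj_ext cyc nonext vc wc).
have [nw|nnw] := eqVneq (next c v) (prev c w).
  by apply: (two_step_fork cyc nonext vc xc vx vw xw wp); rewrite nw next_prev.
have [pw|npw] := eqVneq (prev c v) (next c w).
  apply: (@two_step_fork (rev c) v w x) => //; rewrite ?is_cycle_rev ?mem_rev //.
  - exact: nonext_rev.
  - by rewrite prev_rev.
  by rewrite !next_rev // pw prev_next.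
have nvx := next_not_adj_ext cyc nonext vc xc vx.
have nwx := next_not_adj_ext cyc nonext wc xc wx.
have pvx := prev_not_adj_ext cyc nonext vc xc vx.
have pwx := prev_not_adj_ext cyc nonext wc xc wx.
have u6 : uniq [:: v; x; next c v; prev c v; next c w; prev c w].
  have xNc z : z \in c -> x != z by move=> zc; apply: contraNneq xc => ->.
  rewrite /= !inE !negb_or !xNc ?mem_next ?mem_prev // nnw npw !next_neq_prev //.
  rewrite !(adj_neq vx, adj_neq (adj_next cyc vc), adj_neq (adj_prev cyc vc)).
  have -> : v != next c w by apply: contraNneq nwx => <-.
  have -> : v != prev c w by apply: contraNneq pwx => <-.
  have nvw := adj_neq vw.
  have -> : next c v != next c w by apply: contra_neq nvw => /(can_inj (prev_next uc)).
  by have -> : prev c v != prev c w by apply: contra_neq nvw => /(can_inj (next_prev uc)).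
have: size [:: v; x; next c v; prev c v; next c w; prev c w] <= degree w.
  rewrite -(card_uniqP u6); apply: subset_leq_card; apply/subsetP=> z; rewrite !inE.
  move=> /or4P[| | |/or3P[]] /eqP-> //; rewrite ?adj_next ?adj_prev //.
  by rewrite adj_sym.
by rewrite leqNgt ltnS deg.
Qed.

(** This allows the roles of v and w to be exchanged in [hub_fork]. The vertices v, x, the successor
    of v and both cycle neighbours of w are all of N(w). Of these only v is adjacent to x, so local
    isometry at w joins x to each cycle neighbour of w through v. *)
Lemma neighbor_hub (c : seq G) v w x :
  is_cycle c -> ~ extendable c -> v \in c -> x \notin c -> adj v x ->
  adj v w -> adj x w -> adj w (next c v) -> w != next c (next c v) ->
  next c w != prev c v ->
  adj v (next c w) /\ adj v (prev c w).
Proof.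
move=> cyc nonext vc xc vx vw xw wn wnn nwpv.
have uc : uniq c by case/and3P: cyc.
have wx : adj w x by rewrite adj_sym.
have wc : w \in c.
  apply: contraLR wn => wc; rewrite adj_sym.
  exact: (next_not_adj_ext cyc nonext vc wc).
have nvx := next_not_adj_ext cyc nonext vc xc vx.
have nwx := next_not_adj_ext cyc nonext wc xc wx.
have pwx := prev_not_adj_ext cyc nonext wc xc wx.
have xNc z : z \in c -> x != z by move=> zc; apply: contraNneq xc => ->.
have [wnw wpw] : adj w (next c w) /\ adj w (prev c w) by rewrite adj_next ?adj_prev.
have Nw : adj w =1 mem [:: v; x; next c v; next c w; prev c w].
  apply: adj_mem_max => //=; last by rewrite wx wn wnw wpw adj_sym vw.
  rewrite !inE !negb_or !xNc ?mem_next ?mem_prev // next_neq_prev //.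
  rewrite !(adj_neq vx, adj_neq (adj_next cyc vc)).
  have -> : v != next c w by apply: contraNneq nwx => <-.
  have -> : v != prev c w by apply: contraNneq pwx => <-.
  have -> : next c v != next c w.
    by apply: contra_neq (adj_neq vw) => /(can_inj (prev_next uc)).
  by have -> : next c v != prev c w by apply: contra_neq wnn => ->; rewrite next_prev.
have adj_v z : adj w z -> z \in c -> ~~ adj z x -> adj v z.
  move=> wz zc nzx; rewrite adj_sym in nzx.
  have [u [wu xu zu]] := common_nbr hli wx wz (xNc z zc) nzx.
  move: wu xu zu; rewrite Nw /= !inE => /or4P[|||/orP[]] /eqP->.
  - by rewrite (adj_sym v z).
  - by rewrite adj_irrefl.
  - by rewrite adj_sym (negPf nvx).
  - by rewrite adj_sym (negPf nwx).
  - by rewrite adj_sym (negPf pwx).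
by rewrite !adj_v // ?mem_next ?mem_prev.
Qed.

(** Local isometry at v joins x to the successor of v through w and to the predecessor through w'.
    When neither w nor w' reaches both cycle neighbours, either v and w can be exchanged, or w is
    two steps after v and N(v) violates local isometry. *)
Lemma nonextendable_fork (c : seq G) :
  is_cycle c -> ~ hamiltonian_cycle c -> ~ extendable c ->
  exists a b v w p q : G, fork a b v w p q.
Proof.
move=> cyc nham nonext; have uc : uniq c by case/and3P: cyc.
have [v [x [vc xc vx]]] : exists v x, [/\ v \in c, x \notin c & adj v x].
  case: (pickP [pred e : G * G | [&& e.1 \in c, e.2 \notin c & adj e.1 e.2]]).
    by case=> v x /and3P[vc xc vx]; exists v, x.
  move=> none; case: nham; split=> //; apply/setP=> z; rewrite !inE.
  have [v0 v0c] : exists v0, v0 \in c.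
    by case/and3P: cyc; case: (c) => // v0 ? _ _ _; exists v0; rewrite inE eqxx.
  apply: (connected_closed (P := fun y => y \in c) con v0c) => x y xc xy; apply: contraT => yc.
  by have:= none (x, y); rewrite /= xc yc xy.
have xNc z : z \in c -> x != z by move=> zc; apply: contraNneq xc => ->.
have [vn vp] : adj v (next c v) /\ adj v (prev c v) by rewrite adj_next ?adj_prev.
have nvx := next_not_adj_ext cyc nonext vc xc vx; rewrite adj_sym in nvx.
have pvx := prev_not_adj_ext cyc nonext vc xc vx; rewrite adj_sym in pvx.
have [xn xp] : x != next c v /\ x != prev c v by rewrite !xNc ?mem_next ?mem_prev.
have np : next c v != prev c v by apply: next_neq_prev.
have [w [vw xw nw]] := common_nbr hli vx vn xn nvx.
have [w' [vw' xw' pw']] := common_nbr hli vx vp xp pvx.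
have wn : adj w (next c v) by rewrite adj_sym.
have w'p : adj w' (prev c v) by rewrite adj_sym.
have [wp|nwp] := boolP (adj w (prev c v)).
  exact: (hub_fork cyc nonext vc xc vx vw xw wn wp).
have [w'n|nw'n] := boolP (adj w' (next c v)).
  exact: (hub_fork cyc nonext vc xc vx vw' xw' w'n w'p).
have wc : w \in c.
  apply: contraLR nw => wc; exact: (next_not_adj_ext cyc nonext vc wc).
have [wE|wNE] := eqVneq w (next c (next c v)); last first.
  have nwpv : next c w != prev c v by apply: contraNneq nwp => <-; apply: adj_next.
  have [vnw vpw] := neighbor_hub cyc nonext vc xc vx vw xw wn wNE nwpv.
  by apply: (@hub_fork c w v x) => //; rewrite adj_sym.
(* The successor of v is the predecessor of w, and v and w are both adjacent to x. *)
have nnp : ~~ adj (next c v) (prev c v).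
  have <- : prev c w = next c v by rewrite wE prev_next.
  by apply: (@prevs_not_adj _ c _ _ w v x); rewrite // 1?adj_sym // eq_sym adj_neq.
have ww' : w != w' by apply: contraNneq nwp => ->.
have wNp : w != prev c v by apply: contraNneq pvx => <-.
have w'Nn : w' != next c v by apply: contraNneq nvx => <-.
have Nv : adj v =1 mem [:: x; next c v; prev c v; w; w'].
  apply: adj_mem_max => //=; last by rewrite vx vn vp vw vw'.
  by distinct.
(* None of the five neighbours of v is adjacent to both cycle neighbours of v, which is the
   contradiction. *)
have [u [vu nu pu]] := common_nbr hli vn vp np nnp.
move: vu nu pu; rewrite Nv /= !inE => /or4P[|||/orP[]] /eqP->.
- by rewrite adj_sym (negPf nvx).
- by rewrite adj_irrefl.
- by move=> _; rewrite adj_irrefl.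
- by move=> _; rewrite adj_sym (negPf nwp).
- by rewrite adj_sym (negPf nw'n).
Qed.

End Fork.

(** * Embeddings and the target graphs *)

Definition embedding (H G : sgraph) (f : H -> G) : Prop :=
  injective f /\ forall x y, adj (f x) (f y) = adj x y.

(** Sending [None] to [z] extends the embedding, so iterated attachments can be embedded one vertex
    at a time. *)
Lemma embedding_attach (H G : sgraph) (f : H -> G) (z : G) (u v : H) :
  embedding f -> (forall x, f x != z) ->
  (forall x, adj z (f x) = (x == u) || (x == v)) ->
  @embedding (attach u v) G (oapp f z).
Proof.
move=> [inj_f adj_f] nz adj_z; split.
  move=> [x|] [y|] //= => [/inj_f->//|/eqP|/eqP]; first by rewrite (negPf (nz x)).
  by rewrite eq_sym (negPf (nz y)).
by move=> [x|] [y|] //=; rewrite ?adj_irrefl // adj_sym.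
Qed.

Lemma embedding_isomorphic (H G : sgraph) (f : H -> G) :
  embedding f -> (forall z, exists x, f x = z) -> isomorphic G H.
Proof.
move=> [inj_f adj_f] surj.
have [|g fK gK] := inj_card_bij inj_f.
  apply: leq_trans (leq_image_card f predT); apply: subset_leq_card.
  by apply/subsetP=> z _; have [x <-] := surj z; apply: image_f.
by exists g; [exists f | move=> x y; rewrite -adj_f !gK].
Qed.

Lemma isomorphic_max_degree (G H : sgraph) :
  isomorphic G H -> max_degree H = max_degree G.
Proof.
move=> [f bij_f adj_f]; rewrite /max_degree (reindex f) /=; last exact: onW_bij.
apply: eq_bigr => v _; rewrite /degree -(card_imset _ (bij_inj bij_f)).
have [g fK gK] := bij_f.
apply: eq_card => z; rewrite inE; apply/idP/imsetP => [fvz|[w]].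
  by exists (g z); rewrite ?inE ?gK // -adj_f gK.
by rewrite inE => vw ->; rewrite adj_f.
Qed.

Lemma isomorphic_refl (G : sgraph) : isomorphic G G.
Proof. by exists id => //; exists id. Qed.

Lemma card_closed_nbhd (G : sgraph) (v : G) : #|closed_nbhd v| = (degree v).+1.
Proof. by rewrite cardsU1 inE adj_irrefl. Qed.

(** A lower bound suffices, because shutter pairs only require degree at least 4. *)
Lemma degree_attach (H : sgraph) (u v w : H) :
  degree w + ((w == u) || (w == v)) <= degree (Some w : attach u v).
Proof.
rewrite /degree -(card_imset (nbhd w) (@Some_inj _)) addnC.
have sub : Some @: nbhd w \subset nbhd (Some w : attach u v).
  by apply/subsetP=> x /imsetP[y]; rewrite !inE => wy ->.
have [wuv|_] := boolP ((w == u) || (w == v)); last exact: subset_leq_card.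
have -> : true + #|Some @: nbhd w| = #|None |: Some @: nbhd w|.
  by rewrite cardsU1 (_ : None \notin _) //; apply/negP=> /imsetP[].
by apply: subset_leq_card; rewrite subUset sub sub1set inE /= wuv.
Qed.

Lemma true_twins_attach (H : sgraph) (u v p q : H) :
  true_twins p q -> (p == u) || (p == v) = (q == u) || (q == v) ->
  true_twins (Some p : attach u v) (Some q).
Proof.
move=> [npq /setP tw] uv; split=> [[]//|]; apply/setP=> [[z|]]; rewrite !inE //=.
by have:= tw z; rewrite !inE.
Qed.

(** * Twins and corners of the towers *)

Section Tower.
Variable k : nat.
Implicit Types x y : tower k.

(** The two vertices of [path_graph 2] are adjacent, so the first coordinate imposes no condition
    beyond distinctness of x and y. *)
Lemma tower_adjE x y :
  adj x y = [&& x != y, x.2 <= y.2.+1 & y.2 <= x.2.+1].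
Proof.
case: x y => [s i] [t j]; rewrite /= /strong_adj /= /pathg_adj xpair_eqE -!val_eqE /=.
have := ltn_ord s; have := ltn_ord t; lia.
Qed.

Lemma closed_nbhd_tower x :
  closed_nbhd x = setX [set: 'I_2] [set j : 'I_k | (x.2 <= j.+1) && (j <= x.2.+1)].
Proof.
apply/setP=> -[t j]; rewrite in_setX in_setT in_setU1 [_ \in nbhd _]inE tower_adjE inE.
by rewrite eq_sym; have [->|_] := eqVneq x (t, j); rewrite //= leqnSn.
Qed.

Lemma tower_true_twins x y : x != y -> x.2 = y.2 -> true_twins x y.
Proof. by move=> /eqP nxy e; split=> //; rewrite !closed_nbhd_tower e. Qed.

(** The closed neighbourhood is the product of two 2-element sets, hence has four vertices. *)
Lemma tower_corner_degree x (i : 'I_k) :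
  i != x.2 ->
  (forall j : 'I_k, (x.2 <= j.+1) && (j <= x.2.+1) = (j == x.2) || (j == i)) ->
  degree x = 3.
Proof.
move=> ni near; apply: succn_inj; rewrite -card_closed_nbhd closed_nbhd_tower cardsX.
rewrite cardsT card_ord (_ : [set j | _] = [set x.2; i]) ?cards2 1?eq_sym ?ni //.
by apply/setP=> j; rewrite !inE near.
Qed.

End Tower.

Lemma true_twins_degree (H : sgraph) (u v : H) : true_twins u v -> degree u = degree v.
Proof. by case=> _ e; apply: succn_inj; rewrite -!card_closed_nbhd e. Qed.

Lemma shutter_attach (H : sgraph) (u v p q : H) :
  shutter_pair p q -> (p == u) || (p == v) = (q == u) || (q == v) ->
  @shutter_pair (attach u v) (Some p) (Some q).
Proof.
case=> tw dp dq uv; split; first exact: true_twins_attach.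
  by apply: leq_trans (degree_attach u v p); rewrite (leq_trans dp) ?leq_addr.
by apply: leq_trans (degree_attach u v q); rewrite (leq_trans dq) ?leq_addr.
Qed.

(** Corners of a tower have degree 3. The roof vertex attached to them raises this to 4, so the same
    pair can then carry a shutter. *)
Lemma shutter_new (H : sgraph) (u v : H) :
  true_twins u v -> 3 <= degree u -> @shutter_pair (attach u v) (Some u) (Some v).
Proof.
move=> tw du; have tw' : @true_twins (attach u v) (Some u) (Some v).
  by apply: true_twins_attach; rewrite // !eqxx orbT.
have du' : 4 <= @degree (attach u v) (Some u).
  by apply: leq_trans (degree_attach u v u); rewrite eqxx /= addn1.
by split=> //; rewrite -(true_twins_degree tw').
Qed.

Section Corners.
Variable k : nat.
Implicit Types i : 'I_k.+2.

Lemma tower_pair_twins i : @true_twins (tower k.+2) (ord0, i) (ord_max, i).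
Proof. by apply: tower_true_twins. Qed.

Lemma tower_corner_pair i :
  (i == ord0) || (i == ord_max) -> @corner_pair k.+2 (ord0, i) (ord_max, i).
Proof.
move=> ci; have d3 : @degree (tower k.+2) (ord0, i) = 3.
  have k0 : k < k.+2 by rewrite leqW.
  have [->|->] : i = ord0 \/ i = ord_max by case/orP: ci => /eqP; auto.
    apply: (@tower_corner_degree _ (ord0, ord0) (Ordinal (isT : 1 < k.+2))) => // j.
    by rewrite -!val_eqE /=; lia.
  apply: (@tower_corner_degree _ (ord0, ord_max) (Ordinal k0)) => [|j].
    by rewrite -!val_eqE /=; lia.
  by have := ltn_ord j; rewrite -!val_eqE /=; lia.
split=> //; last by rewrite -(true_twins_degree (tower_pair_twins i)).
by rewrite tower_adjE /= leqnSn.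
Qed.

End Corners.

(** * Ladders *)

Section Ladder.
Variable G : sgraph.
Hypotheses (con : connected G) (hli : locally_isometric G).
Hypotheses (deg : forall v : G, degree v <= 5).

Section Known.
Variables (a b : G) (k : nat) (f : nat -> bool -> G).

(* [f i] is the [i]-th rung of the ladder, and a, b are the leaves of the fork below rung 0. *)
Definition known : pred G :=
  fun z => (z \in [:: a; b]) || [exists e : 'I_k * bool, z == f e.1 e.2].

Lemma known_rung i s : i < k -> known (f i s).
Proof.
by move=> ik; apply/orP; right; apply/existsP; exists (Ordinal ik, s); apply: eqxx.
Qed.

Lemma knownP z :
  known z -> z = a \/ z = b \/ exists i s, i < k /\ z = f i s.
Proof.
rewrite /known !inE => /orP[/orP[]/eqP|/existsP[[i s] /eqP /=]]; auto.
by move=> ->; right; right; exists i, s.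
Qed.

(* The last clause says that only the top rung may have neighbours outside. *)
Definition ladder : Prop :=
  [/\ forall i j s t, i < k -> j < k -> f i s = f j t -> i = j /\ s = t,
      forall i j s t, i < k -> j < k ->
        adj (f i s) (f j t) = [&& (i != j) || (s != t), i <= j.+1 & j <= i.+1],
      a != b /\ (forall i s, i < k -> f i s \notin [:: a; b]),
      adj a =1 mem [:: f 0 true; f 0 false] /\ adj b =1 mem [:: f 0 true; f 0 false]
    & forall i s z, i.+1 < k -> adj (f i s) z -> known z].

End Known.

(** Testing one of the two top vertices is enough, by [adj_top]. *)
Definition top_nbr a b k f z := ~~ known a b k.+2 f z && adj (f k.+1 true) z.

Section Top.
Variables (a b : G) (k : nat) (f : nat -> bool -> G).
Hypothesis lad : ladder a b k.+2 f.

Local Notation old := (known a b k.+2 f).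
Local Notation top := (f k.+1).

Lemma known_adj_unknown u z :
  old u -> ~~ old z -> adj u z -> exists s, u = top s.
Proof.
case: lad => _ _ _ [Na Nb] sat /knownP[->|[->|[i [s [ik ->]]]]] nz.
- rewrite Na !inE => /orP[] /eqP zE; by rewrite zE known_rung in nz.
- rewrite Nb !inE => /orP[] /eqP zE; by rewrite zE known_rung in nz.
move: ik; rewrite ltnS leq_eqVlt => /predU1P[->|ik]; first by exists s.
by move=> /(sat i s z ik) kz; rewrite kz in nz.
Qed.

(** Local isometry at [top s] joins z to the vertex [f k s] of the rung below through some u. Rung k
    has only known neighbours, so u is known; being adjacent to the unknown z, it is a top vertex
    other than [top s]. *)
Lemma adj_top z s t : ~~ old z -> adj (top s) z -> adj (top t) z.
Proof.
move=> nz sz; have [->//|nts] := eqVneq t s.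
have [inj adjE _ _ sat] := lad.
have st : adj (top s) (f k s) by rewrite adjE // gtn_eqF //= leqnn !leqW.
have knk : old (f k s) by apply: known_rung; lia.
have nadj : ~~ adj z (f k s).
  rewrite adj_sym; apply/negP=> /(known_adj_unknown knk nz)[s' /inj] [||]; lia.
have neq : z != f k s by apply: contraNneq nz => ->.
have [u [su zu ku]] := common_nbr hli sz st neq nadj.
have ku' : old u by apply: (sat k s); rewrite // ltnS.
rewrite adj_sym in zu; have [s' uE] := known_adj_unknown ku' nz zu.
suff -> : t = s' by rewrite -uE.
have : s' != s by apply: contraTneq su => e; rewrite uE e adj_irrefl.
by case: (s) (s') (t) nts => [] [] [].
Qed.

Lemma top_nbrE z s : ~~ old z -> adj (top s) z -> top_nbr a b k f z.
Proof. by move=> nz sz; rewrite /top_nbr nz (adj_top _ nz sz). Qed.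

(** A further neighbour u of z would be unknown and not adjacent to the top rung. Its common
    neighbour in N(z) with a top vertex would then be an unknown vertex adjacent to that top vertex
    and to z, which is excluded, or a top vertex, which would make u adjacent to the top rung. *)
Lemma top_nbr_leaf z :
  top_nbr a b k f z -> (forall y, top_nbr a b k f y -> ~~ adj z y) ->
  adj z =1 mem [:: top true; top false].
Proof.
case/andP=> nz tz none u; rewrite /= !inE; apply/idP/idP; last first.
  by case/orP=> /eqP->; rewrite adj_sym //; apply: adj_top tz.
move=> zu; apply: contraT; rewrite negb_or => /andP[ut uf].
have nu : ~~ old u.
  apply/negP=> ku; rewrite adj_sym in zu; have [s uE] := known_adj_unknown ku nz zu.
  by case: s uE => uE; rewrite uE eqxx in ut uf.
have zt : adj z (top true) by rewrite adj_sym.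
have nut : ~~ adj u (top true).
  by apply: contraL zu => ut'; apply: none; rewrite /top_nbr nu adj_sym.
have [w [zw uw tw]] := common_nbr hli zu zt ut nut.
have [kw|nw] := boolP (old w); last first.
  by have:= none w; rewrite zw /top_nbr nw tw => /(_ isT).
rewrite adj_sym in zw; have [s wE] := known_adj_unknown kw nz zw.
by have:= none u; rewrite zu (@top_nbrE u s) // -?wE 1?adj_sym // => /(_ isT).
Qed.

(** Three of the at most five neighbours of [top true] are already taken: the other top vertex and
    both vertices of the rung below. *)
Lemma top_nbrs_le2 (zs : seq G) : uniq zs -> all (top_nbr a b k f) zs -> size zs <= 2.
Proof.
move=> uz /allP tz; have [inj adjE _ _ sat] := lad.
have u3 : uniq [:: f k true, f k false, top false & zs].
  have nz i s : i < k.+2 -> f i s \notin zs.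
    by move=> ik; apply/negP=> /tz /andP[]; rewrite known_rung.
  rewrite /= !inE !negb_or !nz ?ltnS // uz !andbT -andbA; apply/and3P; split.
  1-3: by apply/eqP=> e; have [||] := inj _ _ _ _ _ _ e; lia.
have: size [:: f k true, f k false, top false & zs] <= degree (top true).
  rewrite -(card_uniqP u3); apply: subset_leq_card; apply/subsetP=> z; rewrite !inE.
  case/or4P=> [/eqP->|/eqP->|/eqP->|/tz/andP[] //]; rewrite adjE //; lia.
by move=> /leq_trans/(_ (deg _)).
Qed.

Lemma ladder_cover (zs : seq G) :
  (forall z, top_nbr a b k f z -> z \in zs) ->
  (forall z, z \in zs -> adj z =1 mem [:: top true; top false]) ->
  forall z, old z || (z \in zs).
Proof.
move=> Zzs leaf; have ka : old a by rewrite /known inE eqxx.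
apply: (connected_closed (P := fun z => old z || (z \in zs)) con (x0 := a)).
  by rewrite ka.
move=> x y /orP[kx|xz] xy.
  have [//|ny] := boolP (old y).
  have [s xE] := known_adj_unknown kx ny xy.
  by rewrite (Zzs y) ?orbT // (@top_nbrE y s) // -xE.
by move: xy; rewrite (leaf x xz) /= !inE => /orP[] /eqP->; rewrite known_rung.
Qed.

(** The vertices z1 and z2 form the new rung. The old top rung becomes saturated, because
    [top_nbrs_le2] excludes a third unknown neighbour. *)
Lemma ladder_grow z1 z2 :
  top_nbr a b k f z1 -> top_nbr a b k f z2 -> adj z1 z2 ->
  ladder a b k.+3 (fun i s => if i == k.+2 then if s then z1 else z2 else f i s).
Proof.
set f' := fun i s => _.
move=> t1 t2 z12; have [inj adjE [nab nf] [Na Nb] sat] := lad.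
pose z s := if s then z1 else z2.
have tz s : top_nbr a b k f (z s) by case: s.
have nz s : ~~ old (z s) by case/andP: (tz s).
have n12 := adj_neq z12.
have adj_z i s t : i < k.+2 -> adj (f i s) (z t) = (i == k.+1).
  move=> ik; apply/idP/eqP => [|->].
    by case/(known_adj_unknown (known_rung a b f s ik) (nz t)) => s' /inj[].
  by case/andP: (tz t) => nzt; apply: adj_top.
have fz i s t : i < k.+2 -> f i s <> z t.
  by move=> ik fE; have:= nz t; rewrite -fE known_rung.
have f'E i s : i < k.+3 -> (i = k.+2 /\ f' i s = z s) \/ (i < k.+2 /\ f' i s = f i s).
  rewrite ltnS leq_eqVlt /f' => /predU1P[->|ik]; first by left; rewrite eqxx.
  by right; rewrite ltn_eqF.
have f'_old i s : i < k.+2 -> f' i s = f i s by move=> ik; rewrite /f' ltn_eqF.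
have f'_new s : f' k.+2 s = z s by rewrite /f' eqxx.
have known_new s : known a b k.+3 f' (z s) by rewrite -f'_new known_rung.
have known_old y : old y -> known a b k.+3 f' y.
  case/knownP=> [->|[->|[i [s [ik ->]]]]]; rewrite -1?f'_old ?known_rung ?(ltnW ik) //.
  - by rewrite /known inE eqxx.
  - by rewrite /known !inE eqxx orbT.
  - exact: ltnW.
split.
- move=> i j s t ik jk.
  have [[-> ->]|[ik' ->]] := f'E i s ik; have [[-> ->]|[jk' ->]] := f'E j t jk.
  + by case: s t => [] [] //= e; rewrite e eqxx in n12.
  + by move=> /esym /fz-/(_ jk').
  + by move=> /fz-/(_ ik').
  + exact: inj.
- move=> i j s t ik jk.
  have [[-> ->]|[ik' ->]] := f'E i s ik; have [[-> ->]|[jk' ->]] := f'E j t jk.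
  + rewrite eqxx leqnSn /= andbT.
    by case: s t => [] [] /=; rewrite ?adj_irrefl // adj_sym.
  + by rewrite adj_sym adj_z //; clear -jk'; lia.
  + by rewrite adj_z //; clear -ik'; lia.
  + exact: adjE.
- split=> // i s ik; have [[_ ->]|[ik' ->]] := f'E i s ik; last exact: nf.
  by have:= nz s; rewrite /known negb_or => /andP[].
- by split=> y; rewrite ?Na ?Nb.
move=> i s y; rewrite ltnS => ik; rewrite f'_old // => iy.
have [ky|ny] := boolP (old y); first exact: known_old.
have [s' fE] := known_adj_unknown (known_rung a b f s ik) ny iy.
have ty : top_nbr a b k f y by apply: (@top_nbrE y s'); rewrite // -fE.
have [->|ny1] := eqVneq y z1; first exact: (known_new true).
have [->|ny2] := eqVneq y z2; first exact: (known_new false).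
have:= @top_nbrs_le2 [:: y; z1; z2]; rewrite /= !inE negb_or ny1 ny2 n12 ty t1 t2.
by move=> /(_ isT isT).
Qed.

End Top.

Lemma ladder_embedding a b k f :
  ladder a b k f ->
  @embedding (tower k) G (fun x => f x.2 (x.1 == 0 :> nat)).
Proof.
case=> inj adjE _ _ _; split=> [[s i] [t j] /= e | x y].
  have [ij st] := inj _ _ _ _ (ltn_ord i) (ltn_ord j) e.
  congr (_, _); apply: val_inj => //=; move: st.
  by have := ltn_ord s; have := ltn_ord t; lia.
rewrite adjE // tower_adjE; case: x y => [s i] [t j]; rewrite xpair_eqE -!val_eqE /=.
by have := ltn_ord s; have := ltn_ord t; clear; lia.
Qed.

(** With no vertex above the top rung, or exactly one, G is singly shuttered; with two nonadjacent
    ones it is doubly shuttered; with two adjacent ones the ladder grows. Throughout, a serves as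
    roof vertex of the highrise and b as shutter on the same bottom pair. *)
Lemma ladder_exceptional a b k f :
  max_degree G = 5 -> ladder a b k.+2 f ->
  (exists m, is_singly_shuttered m G) \/ (exists m, is_doubly_shuttered m G).
Proof.
move=> max5.
have [n] := ubnP (#|G| - k); elim: n k f => // n IH k f le_n lad.
have [inj adjE [nab nf] [Na Nb] sat] := lad.
pose e0 (x : tower k.+2) := f x.2 (x.1 == 0 :> nat).
have emb0 : embedding e0 := ladder_embedding lad.
pose u0 : tower k.+2 := (ord0, ord0); pose v0 : tower k.+2 := (ord_max, ord0).
pose x0 : tower k.+2 := (ord0, ord_max); pose y0 : tower k.+2 := (ord_max, ord_max).
have cuv : corner_pair u0 v0 by apply: tower_corner_pair; rewrite eqxx.
have cxy : corner_pair x0 y0 by apply: tower_corner_pair; rewrite eqxx orbT.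
have e0_old x : e0 x \notin [:: a; b] by apply: nf.
have adj_ab x : (adj a (e0 x) = (x == u0) || (x == v0)) *
                (adj b (e0 x) = (x == u0) || (x == v0)).
  have -> : (x == u0) || (x == v0) = (e0 x \in [:: e0 u0; e0 v0]).
    by rewrite !inE !(inj_eq (proj1 emb0)).
  by rewrite Na Nb.
have [ea eb] : (forall x, e0 x != a) /\ (forall x, e0 x != b).
  by split=> x; have:= e0_old x; rewrite !inE negb_or => /andP[].
have nadj_ba : adj b a = false.
  by rewrite Nb /= !inE !(eq_sym a) (negPf (ea u0)) (negPf (ea v0)).
have emb1 : @embedding (attach u0 v0) G (oapp e0 a).
  by apply: embedding_attach => // x; apply: (adj_ab x).1.
have twins_uv : true_twins u0 v0 by apply: tower_pair_twins.
have twins_xy : true_twins x0 y0 by apply: tower_pair_twins.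
have shut1 : @shutter_pair (attach u0 v0) (Some u0) (Some v0).
  by apply: shutter_new; case: cuv => // _ ->.
have old_cases z : known a b k.+2 f z -> z = a \/ z = b \/ exists x, e0 x = z.
  case/knownP=> [->|[->|[i [s [ik ->]]]]]; auto; right; right.
  by exists ((if s then ord0 else ord_max), Ordinal ik); case: s.
have [z1 t1|no_top] := pickP (top_nbr a b k f); last first.
  have cover z : z = a \/ z = b \/ exists x, e0 x = z.
    have:= @ladder_cover a b k f lad [::] _ _ z; rewrite orbF => /(_ _ _)/old_cases; apply=> //.
    by move=> y; rewrite no_top.
  (* The tower with roof vertex a is the odd highrise of order [2 * k.+2 + 1]; b is its shutter. *)
  have iso : isomorphic G (@attach (attach u0 v0) (Some u0) (Some v0)).
    have emb : @embedding (@attach (attach u0 v0) (Some u0) (Some v0)) G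
        (oapp (oapp e0 a) b).
      apply: embedding_attach => // [[x|]|[x|]] //=.
      by rewrite (adj_ab x).2.
    apply: (embedding_isomorphic emb) => z; have [->|[->|[x <-]]] := cover z.
      by exists (Some None).
      by exists None.
    by exists (Some (Some x)).
  left; exists (2 * k.+2 + 2); right; split; first by clear; lia.
  exists (attach u0 v0).
    exists k.+2; split=> //; left; split; first by clear; lia.
    by exists u0, v0; split=> //; apply: isomorphic_refl.
  by exists (Some u0), (Some v0); split; rewrite ?(isomorphic_max_degree iso).
have top_apart z : top_nbr a b k f z ->
    [/\ forall x, e0 x != z, a != z, b != z, adj z a = false & adj z b = false].
  case/andP=> nz _; have nzf i s : i < k.+2 -> z != f i s.
    by move=> ik; apply: contraNneq nz => ->; apply: known_rung.
  split; rewrite 1?(adj_sym z) ?Na ?Nb /= ?inE ?(negPf (nzf _ _ _)) //.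
  - by move=> x; rewrite eq_sym nzf.
  - by apply: contraNneq nz => <-; rewrite /known inE eqxx.
  - by apply: contraNneq nz => <-; rewrite /known !inE eqxx orbT.
have adj_leaf z x : adj z =1 mem [:: f k.+1 true; f k.+1 false] ->
    adj z (e0 x) = (x == x0) || (x == y0).
  move=> Nz; rewrite Nz -[f k.+1 true]/(e0 x0) -[f k.+1 false]/(e0 y0) /= !inE.
  by rewrite !(inj_eq (proj1 emb0)).
have disj : [disjoint [set u0; v0] & [set x0; y0]].
  rewrite -setI_eq0; apply/eqP/setP=> -[s i]; rewrite !inE !xpair_eqE.
  by rewrite -!val_eqE /=; lia.
have twins_xy1 : @true_twins (attach u0 v0) (Some x0) (Some y0).
  by apply: true_twins_attach; rewrite // !xpair_eqE -!val_eqE.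
have shut_uv : @shutter_pair (attach2 u0 v0 x0 y0) (Some (Some u0)) (Some (Some v0)).
  by apply: shutter_attach; rewrite // !(inj_eq (@Some_inj _)) !xpair_eqE -!val_eqE.
have shut_xy : @shutter_pair (attach2 u0 v0 x0 y0) (Some (Some x0)) (Some (Some y0)).
  apply: shutter_new => //; apply: leq_trans (degree_attach u0 v0 x0).
  by case: cxy => _ -> _; rewrite leq_addr.
have highrise2 : is_highrise (2 * k.+2 + 2) (attach2 u0 v0 x0 y0).
  exists k.+2; split=> //; right; split=> //; exists u0, v0, x0, y0.
  by split=> //; apply: isomorphic_refl.
have embed2 z : top_nbr a b k f z -> adj z =1 mem [:: f k.+1 true; f k.+1 false] ->
    @embedding (attach2 u0 v0 x0 y0) G (oapp (oapp e0 a) z).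
  move=> tz Nz; have [ez az bz za zb] := top_apart z tz.
  by apply: embedding_attach => // [[x|]|[x|]] //=; rewrite adj_leaf.
have embed3 z : top_nbr a b k f z -> adj z =1 mem [:: f k.+1 true; f k.+1 false] ->
    @embedding (attach (Some (Some u0) : attach2 u0 v0 x0 y0) (Some (Some v0))) G
      (oapp (oapp (oapp e0 a) z) b).
  move=> tz Nz; have [ez az bz za zb] := top_apart z tz.
  apply: embedding_attach; first exact: embed2.
    by move=> [[x|]|] //=; rewrite eq_sym.
  by move=> [[x|]|] //=; rewrite ?(adj_ab x).2 // adj_sym.
have [z2 /andP[t2 n21]|no_other] := pickP [pred z | top_nbr a b k f z && (z != z1)]; last first.
  have only_z1 z : top_nbr a b k f z -> z = z1.
    by move=> tz; have:= no_other z; rewrite /= tz => /negbFE/eqP.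
  have Nz1 : adj z1 =1 mem [:: f k.+1 true; f k.+1 false].
    by apply: (@top_nbr_leaf a b k f) => // y /only_z1->; rewrite adj_irrefl.
  have cover z : z = a \/ z = b \/ z = z1 \/ exists x, e0 x = z.
    have:= @ladder_cover a b k f lad [:: z1] _ _ z; rewrite inE => /(_ _ _)/orP[].
    - by move=> y /only_z1->; rewrite inE.
    - by move=> y; rewrite inE => /eqP->.
    - by case/old_cases=> [|[|]]; auto.
    - by move/eqP; auto.
  have iso := embedding_isomorphic (embed3 z1 t1 Nz1).
  have {}iso := iso _.
  (* Now z1 is the roof vertex at the top, giving the even highrise of order [2 * k.+2 + 2], with b
     as its only shutter. *)
  have iso' : isomorphic G
      (attach (Some (Some u0) : attach2 u0 v0 x0 y0) (Some (Some v0))).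
    apply: iso => z; have [->|[->|[->|[x <-]]]] := cover z.
    - by exists (Some (Some None)).
    - by exists None.
    - by exists (Some None).
    - by exists (Some (Some (Some x))).
  left; exists (2 * k.+2 + 3); right; split; first by clear; lia.
  exists (attach2 u0 v0 x0 y0); first by rewrite (_ : _.-1 = 2 * k.+2 + 2) //; clear; lia.
  exists (Some (Some u0)), (Some (Some v0)).
  by split; rewrite ?(isomorphic_max_degree iso').
have n12 : z1 != z2 by rewrite eq_sym.
have [z12|nz12] := boolP (adj z1 z2).
  apply: IH (ladder_grow lad t1 t2 z12).
  (* One side of the ladder has [k.+2] distinct vertices, so the truncated difference [#|G| - k]
     really decreases. *)
  have inj_f : injective (fun i : 'I_k.+2 => f i true).
    by move=> i j /inj[] // ij _; apply: val_inj.
  by have:= leq_card _ inj_f; rewrite card_ord; clear -le_n; lia.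
have only_z z : top_nbr a b k f z -> z \in [:: z1; z2].
  move=> tz; apply: contraT; rewrite !inE negb_or => /andP[zz1 zz2].
  have:= @top_nbrs_le2 a b k f lad [:: z; z1; z2]; rewrite /= !inE negb_or zz1 zz2 n12 tz t1 t2.
  by move=> /(_ isT isT).
have leaf z : z \in [:: z1; z2] -> adj z =1 mem [:: f k.+1 true; f k.+1 false].
  move=> zz; have tz : top_nbr a b k f z by move: zz; rewrite !inE => /orP[]/eqP->.
  apply: (@top_nbr_leaf a b k f) => // y /only_z; move: zz; rewrite !inE.
  by do 2 case/orP=> /eqP->; rewrite ?adj_irrefl // adj_sym.
have cover z : z = a \/ z = b \/ z = z1 \/ z = z2 \/ exists x, e0 x = z.
  have:= @ladder_cover a b k f lad [:: z1; z2] only_z leaf z; rewrite !inE.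
  by case/or3P=> [/old_cases[|[|]]|/eqP|/eqP]; auto.
have L1 : adj z1 =1 mem [:: f k.+1 true; f k.+1 false] by apply: leaf; rewrite mem_head.
have L2 : adj z2 =1 mem [:: f k.+1 true; f k.+1 false].
  by apply: leaf; rewrite !inE eqxx orbT.
(* Of the two leaves at the top, z1 is the roof vertex and z2 the second shutter. *)
have iso : isomorphic G (@attach2 (attach2 u0 v0 x0 y0)
    (Some (Some u0)) (Some (Some v0)) (Some (Some x0)) (Some (Some y0))).
  have [e1 a1 b1 z1a z1b] := top_apart z1 t1; have [e2 a2 b2 z2a z2b] := top_apart z2 t2.
  have emb : @embedding (@attach2 (attach2 u0 v0 x0 y0)
      (Some (Some u0)) (Some (Some v0)) (Some (Some x0)) (Some (Some y0))) G
      (oapp (oapp (oapp (oapp e0 a) z1) b) z2).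
    apply: embedding_attach; first exact: embed3.
      by move=> [[[x|]|]|] //=.
    move=> [[[x|]|]|] //=; first by rewrite adj_leaf.
    by rewrite adj_sym (negPf nz12).
  apply: (embedding_isomorphic emb) => z; have [->|[->|[->|[->|[x <-]]]]] := cover z.
  - by exists (Some (Some (Some None))).
  - by exists (Some None).
  - by exists (Some (Some None)).
  - by exists None.
  - by exists (Some (Some (Some (Some x)))).
right; exists (2 * k.+2 + 4); right; split; first by clear; lia.
split; first by rewrite oddD oddM.
exists (attach2 u0 v0 x0 y0); first by rewrite (_ : _ - 2 = 2 * k.+2 + 2) //; clear; lia.
exists (Some (Some u0)), (Some (Some v0)), (Some (Some x0)), (Some (Some y0)).
by split; rewrite ?(isomorphic_max_degree iso).
Qed.

End Ladder.

(** * From forks to the exceptional graphs, and triangles *)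

Lemma fork_split (G : sgraph) (a b v w p q : G) :
  connected G -> fork a b v w p q ->
  adj p =1 mem [:: v; w] -> adj q =1 mem [:: v; w] ->
  isomorphic G (join (complete_graph 2) (complement (complete_graph 4))).
Proof.
move=> con [u6 Nv Nw Na Nb] Np Nq.
pose S := [:: a; b; p; q].
have : uniq ([:: v; w] ++ S).
  by rewrite (perm_uniq (s2 := [:: a; b; v; w; p; q])) // (perm_catCA [:: v; w] [:: a; b]).
rewrite cat_uniq => /and3P[uvw /hasPn disj uS].
have leaf r z : r \in S -> adj r z = (z \in [:: v; w]).
  by rewrite !inE => /or4P[] /eqP->; rewrite ?Na ?Nb ?Np ?Nq /= !inE.
pose g (x : join (complete_graph 2) (complement (complete_graph 4))) : G :=
  match x with inl i => nth v [:: v; w] i | inr j => nth a S j end.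
have gl i : g (inl i) \in [:: v; w] by apply: mem_nth.
have gr j : g (inr j) \in S by apply: mem_nth.
have nlr i j : g (inl i) <> g (inr j).
  by move=> e; have:= disj _ (gr j); rewrite -e gl.
have emb : embedding g.
  split=> [[i|i] [j|j] e|[i|i] [j|j]].
  - congr inl; apply: val_inj; apply/eqP; move/eqP: e; rewrite /= nth_uniq //; exact: ltn_ord.
  - by case: (nlr _ _ e).
  - by case: (nlr _ _ (esym e)).
  - congr inr; apply: val_inj; apply/eqP; move/eqP: e; rewrite /= nth_uniq //; exact: ltn_ord.
  - have vw : adj v w by rewrite Nv /= inE eqxx.
    case: i j => [[|[|//]] ?] [[|[|//]] ?]; rewrite /= /complete_adj -val_eqE /= ?adj_irrefl //.
    by rewrite adj_sym.
  - by rewrite adj_sym leaf ?gl ?gr.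
  - by rewrite leaf ?gl ?gr.
  - by rewrite leaf ?gr // (negPf (disj _ (gr j))) [RHS]/= /compl_adj andbN.
have cover : forall z, z \in [:: v; w] ++ S.
  apply: (connected_closed (P := fun z => z \in [:: v; w] ++ S) con (mem_head _ _)).
  move=> x y; rewrite !mem_cat => /orP[|xS]; last by rewrite leaf // => ->.
  rewrite !inE => /orP[]/eqP->; rewrite ?Nv ?Nw /= !inE => /orP[->|->]; by rewrite ?orbT.
apply: (embedding_isomorphic emb) => z; have:= cover z; rewrite mem_cat => /orP[] zin.
  have lt : index z [:: v; w] < 2 by rewrite -[2]/(size [:: v; w]) index_mem.
  by exists (inl (Ordinal lt)); rewrite /= nth_index.
have lt : index z S < 4 by rewrite -[4]/(size S) index_mem.
by exists (inr (Ordinal lt)); rewrite /g nth_index.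
Qed.

(** This starts the induction: v, w are rung 0 and p, q rung 1. Rung 0 is saturated because the
    neighbourhoods of v and w consist of vertices of the fork. *)
Lemma fork_ladder (G : sgraph) (a b v w p q : G) :
  fork a b v w p q -> adj p q ->
  ladder a b 2 (fun i s => if i is 0 then if s then v else w else if s then p else q).
Proof.
move=> [u6 Nv Nw Na Nb] pq; set f := fun i s => _.
move: u6; rewrite /= !inE !negb_or -!andbA.
do 15 ?[case/andP=> ?]; move=> _.
have vw : adj v w by rewrite Nv /= inE eqxx.
have vp : adj v p by rewrite Nv /= !inE eqxx !orbT.
have vq : adj v q by rewrite Nv /= !inE eqxx !orbT.
have wp : adj w p by rewrite Nw /= !inE eqxx !orbT.
have wq : adj w q by rewrite Nw /= !inE eqxx !orbT.
split.
- move=> [|[|//]] [|[|//]] [] [] //= _ _ /eqP e; exfalso; move: e; apply/negP; distinct.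
- move=> [|[|//]] [|[|//]] [] [] //= _ _; rewrite ?adj_irrefl // adj_sym //.
- split=> // -[|[|//]] [] _ /=; distinct.
- by split.
move=> [|//] s z _ sz; have : z \in [:: a; b; v; w; p; q].
  case: s sz; rewrite /= ?Nv ?Nw /= !inE => /predU1P[->|]; rewrite ?eqxx ?orbT //.
    by case/or4P=> ->; rewrite ?orbT.
  by case/or4P=> ->; rewrite ?orbT.
have kf i s' : i < 2 -> known a b 2 f (f i s') by apply: known_rung.
rewrite !inE orbA => /orP[ab|].
  by rewrite /known !inE ab.
case/or4P=> /eqP->; [exact: (kf 0 true) | exact: (kf 0 false) | |].
  exact: (kf 1 true).
exact: (kf 1 false).
Qed.

(** If p and q are nonadjacent, [leaf_nbhd] makes them leaves as well, so G is the join of the edge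
    vw with four independent vertices, that is, [D_6]. *)
Lemma fork_exceptional (G : sgraph) (a b v w p q : G) :
  connected G -> locally_isometric G -> max_degree G = 5 -> fork a b v w p q ->
  (exists m, is_singly_shuttered m G) \/ (exists m, is_doubly_shuttered m G).
Proof.
move=> con hli max5 fk; have [u6 Nv Nw Na Nb] := fk.
have deg (z : G) : degree z <= 5 by have := degree_le_max z; rewrite max5.
have [pq|npq] := boolP (adj p q).
  exact: (ladder_exceptional con hli deg max5 (fork_ladder fk pq)).
have apart r : r \in [:: p; q] -> ~~ adj r a /\ ~~ adj r b.
  rewrite !(adj_sym r) Na Nb /= !inE !negb_or => rpq.
  by move: u6 rpq; rewrite /= !inE !negb_or -!andbA;
     do 14 ?[case/andP=> ?]; move=> _ /orP[] /eqP->; split; distinct.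
have leaf r : r \in [:: p; q] -> adj r =1 mem [:: v; w].
  move=> rpq; have [nra nrb] := apart r rpq.
  apply: (leaf_nbhd hli Nv Nw); first by move: rpq; rewrite !inE => /orP[] ->; rewrite ?orbT.
  have rr u : u \in [:: p; q] -> ~~ adj r u.
    by move: rpq; rewrite !inE => /orP[]/eqP-> /orP[]/eqP->; rewrite ?adj_irrefl // adj_sym.
  by move=> u; rewrite !inE => /or4P[] /eqP-> //; apply: rr; rewrite !inE eqxx ?orbT.
right; exists 6; left; split=> //.
by apply: (fork_split con fk); apply: leaf; rewrite !inE eqxx ?orbT.
Qed.

(** Connectivity gives a neighbour u of v and a third vertex z adjacent to u or v. If these three
    vertices do not form a triangle, local isometry at the middle vertex of the resulting path
    supplies one through v. *)
Lemma in_triangle (G : sgraph) (v : G) :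
  connected G -> locally_isometric G -> 2 < #|G| ->
  exists c : seq G, [/\ is_cycle c, size c = 3 & v \in c].
Proof.
move=> con hli ord.
have triangle u w : adj v u -> adj u w -> adj v w ->
    exists c : seq G, [/\ is_cycle c, size c = 3 & v \in c].
  move=> vu uw vw; exists [:: v; u; w]; split; rewrite ?inE ?eqxx //.
  apply/and3P; split=> //; first by rewrite /= vu uw adj_sym vw.
  by distinct.
have escape (s : seq G) : v \in s -> size s <= 2 ->
    exists u z, [/\ u \in s, adj u z & z \notin s].
  move=> vs s2.
  case: (pickP [pred e : G * G | [&& e.1 \in s, adj e.1 e.2 & e.2 \notin s]]).
    by case=> u z /and3P[us uz zs]; exists u, z.
  move=> none; have all_s : forall z, z \in s.
    apply: (connected_closed (P := fun z => z \in s) con vs) => y z ys yz.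
    by apply: contraT => zs; have:= none (y, z); rewrite /= ys yz zs.
  have: #|G| <= size s.
    by apply: leq_trans (card_size _); apply: subset_leq_card; apply/subsetP=> z _.
  by rewrite leqNgt (leq_ltn_trans s2 ord).
have [u vu] : exists u, adj v u.
  have [//|//|u [z [+ uz _]]] := escape [:: v]; first by rewrite mem_head.
  by rewrite inE => /eqP uE; exists z; rewrite -uE.
have [//|//|x [z [xin xz]]] := escape [:: v; u]; first by rewrite mem_head.
rewrite !inE negb_or => /andP[zv zu].
move: xin; rewrite !inE => /orP[] /eqP xE; subst x.
  have [uz|nuz] := boolP (adj u z); first exact: (triangle u z).
  have [|r [vr ur zr]] := common_nbr hli vu xz _ nuz; first by rewrite eq_sym.
  exact: (triangle u r).
have uv : adj u v by rewrite adj_sym.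
have [vz|nvz] := boolP (adj v z); first exact: (triangle u z).
have [|r [ur vr zr]] := common_nbr hli uv xz _ nvz; first by rewrite eq_sym.
exact: (triangle u r).
Qed.

Theorem theorem1 (G : sgraph) (n : nat)
    (hconn : connected G) (hli : locally_isometric G)
    (hord : #|G| = n) (hn : 6 <= n) (hdeg : max_degree G = 5) :
  fully_cycle_extendable G \/
  (exists m, is_singly_shuttered m G) \/
  (exists m, is_doubly_shuttered m G).
Proof.
have card6 : 5 < #|G| by rewrite hord.
have deg (v : G) : degree v <= 5 by have := degree_le_max v; rewrite hdeg.
have [[a [b [v [w [p [q fk]]]]]]|no_fork] :=
    classic (exists a b v w p q : G, fork a b v w p q).
  by right; apply: fork_exceptional fk.
left; split=> [c cyc nham|v]; last by apply: in_triangle => //; apply: ltn_trans card6.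
by apply: NNPP => nonext; apply: no_fork; apply: (nonextendable_fork hconn hli deg card6 cyc).
Qed.
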